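(* Let $\{(G_i,\tau_i):i\in I\}$ and $\{(H_i,\sigma_i):i\in I\}$ be families of topological groups and $f_i:(G_i,\tau_i)\to(H_i,\sigma_i)$ a continuous surjective homomorphism for every $i\in I$. Let $G=\prod_{i\in I}G_i$ with the product topology $\tau=\prod_{i\in I}\tau_i$, $H=\prod_{i\in I}H_i$ with the product topology $\sigma=\prod_{i\in I}\sigma_i$, and $f=\prod_{i\in I}f_i:(G,\tau)\to(H,\sigma)$. (a) If $f_i$ is semitopological for every $i\in I$, then $f$ is semitopological. (b) $f_i$ is A-open for every $i\in I$ if and only if $f$ is A-open. (c) $f_i$ is A$^*$-open for every $i\in I$ if and only if $f$ is A$^*$-open. (d) $f_i$ is strongly A$^*$-open for every $i\in I$ if and only if $f$ is strongly A$^*$-open. (e) $f_i$ is strongly A-open for every $i\in I$ if and only if $f$ is strongly A-open.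
   Context: Topological groups are not assumed Hausdorff. $\mathcal V_{(G,\tau)}(e_G)$ is the filter of all neighborhoods of $e_G$ in $(G,\tau)$. For a neighborhood $U$ of $e_G$, a subset $M\subseteq G$ is $U$-thin if $\bigcap\{x^{-1}Ux:x\in M\}$ is a neighborhood of $e_G$. Write $[x,y]=xyx^{-1}y^{-1}$ and, for $g\in G$ and $K\subseteq G$, $[g,K]=\{[g,k]:k\in K\}$. A section of a surjective homomorphism $f:G\to H$ is an injective function $s:H\to G$ such that $f(s(h))=h$ for every $h\in H$ and $s(e_H)=e_G$ (no continuity required). A map $t:H\to G$ between topological groups is a quasihomomorphism if $t(e_H)=e_G$, the map $t':H\times H\to G$, $t'(h_1,h_2)=t(h_1)t(h_2)t(h_1h_2)^{-1}$, is continuous at $(e_H,e_H)$, and for every $y\in H$ the map $t_y:H\to G$, $t_y(h)=t(y)t(h)t(y)^{-1}t(yhy^{-1})^{-1}$, is continuous at $e_H$. Let $f:(G,\tau)\to(H,\sigma)$ be a surjective homomorphism. - $f$ is A-open if for every $U\in\mathcal V_{(G,\tau)}(e_G)$ there exists $V\in\mathcal V_{(H,\sigma)}(e_H)$ such that $f^{-1}(V)$ is $f^{-1}(f(U))$-thin, and for every $g\in G$ there exists $V_g\in\mathcal V_{(H,\sigma)}(e_H)$ such that $[g,f^{-1}(V_g)]\subseteq f^{-1}(f(U))$. - $f$ is A$^*$-open if there exists a section $s$ of $f$ such that for every $U\in\mathcal V_{(G,\tau)}(e_G)$ there exists $V\in\mathcal V_{(H,\sigma)}(e_H)$ such that $s(V)$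 is $U$-thin, and for every $g\in G$ there exists $V_g\in\mathcal V_{(H,\sigma)}(e_H)$ such that $[g,s(V_g)]\subseteq U$; if such an $s$ can be chosen to be also a quasihomomorphism, $f$ is strongly A$^*$-open. - $f$ is strongly A-open if for every $U\in\mathcal V_{(G,\tau)}(e_G)$ there exists $V\in\mathcal V_{(H,\sigma)}(e_H)$ such that $f^{-1}(V)$ is $U$-thin, and for every $g\in G$ there exists $V_g\in\mathcal V_{(H,\sigma)}(e_H)$ such that $[g,f^{-1}(V_g)]\subseteq U$. - If $f$ is continuous, $f$ is semitopological if there exist a topological group $(\widetilde G,\widetilde\tau)$ containing $G$ as a topological normal subgroup (i.e. $G$ is, up to identification, a normal subgroup of $\widetilde G$ and $\widetilde\tau\restriction_G=\tau$) and an open continuous homomorphism $\widetilde f:(\widetilde G,\widetilde\tau)\to(H,\sigma)$ extending $f$. *)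

(* Defs.v *)
From HB Require Import structures.
From mathcomp Require Import all_boot all_classical.
From mathcomp Require Import topology.

Set Implicit Arguments.
Unset Strict Implicit.
Unset Printing Implicit Defensive.

Local Open Scope classical_set_scope.
Local Open Scope group_scope.

(* No separation axiom: topological groups need not be Hausdorff. *)
HB.mixin Record isTopologicalGroup G of Topological G & Group G := {
  mulg_continuous : continuous (fun x : G * G => x.1 * x.2);
  invg_continuous : continuous (fun x : G => x^-1)
}.

#[short(type="topologicalGroupType")]
HB.structure Definition TopologicalGroup :=
  {G of Topological G & Group G & isTopologicalGroup G}.

Section ProductGroup.
Variables (I : Type) (G : I -> topologicalGroupType).
Let P := prod_topology G.

Definition prodg_mul (x y : P) : P := fun i => x i * y i.
Definition prodg_one : P := fun i => 1.
Definition prodg_inv (x : P) : P := fun i => (x i)^-1.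

Fact prodg_mulA : associative prodg_mul.
Proof.
by move=> x y z; apply: functional_extensionality_dep => i; exact: mulgA.
Qed.

Fact prodg_mul1g : left_id prodg_one prodg_mul.
Proof.
by move=> x; apply: functional_extensionality_dep => i; exact: mul1g.
Qed.

Fact prodg_mulg1 : right_id prodg_one prodg_mul.
Proof.
by move=> x; apply: functional_extensionality_dep => i; exact: mulg1.
Qed.

Fact prodg_mulVg : left_inverse prodg_one prodg_inv prodg_mul.
Proof.
by move=> x; apply: functional_extensionality_dep => i; exact: mulVg.
Qed.

Fact prodg_mulgV : right_inverse prodg_one prodg_inv prodg_mul.
Proof.
by move=> x; apply: functional_extensionality_dep => i; exact: mulgV.
Qed.

HB.instance Definition _ := isGroup.Build (prod_topology G)
  prodg_mulA prodg_mul1g prodg_mulg1 prodg_mulVg prodg_mulgV.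

Lemma prodg_proj_continuous i : continuous (fun x : prod_topology G => x i).
Proof. exact: (@proj_continuous {classic I} G i). Qed.

Lemma prodg_continuous (T : topologicalType) (h : T -> prod_topology G) :
  (forall i, continuous (fun t => h t i)) -> continuous h.
Proof.
move=> hc t; apply/cvg_sup => i U [V [[W oW <-] /= Wt] WU].
apply: (filterS WU); apply: (hc i t); exact: open_nbhs_nbhs.
Qed.

Fact prodg_mul_continuous :
  continuous (fun x : prod_topology G * prod_topology G => x.1 * x.2).
Proof.
apply: prodg_continuous => i x.
have c1 : (fun y : prod_topology G * prod_topology G => y.1 i) @ x --> x.1 i.
  apply: (@continuous_comp _ _ _ fst (fun z : prod_topology G => z i)).
    exact: cvg_fst.
  exact: prodg_proj_continuous.
have c2 : (fun y : prod_topology G * prod_topology G => y.2 i) @ x --> x.2 i.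
  apply: (@continuous_comp _ _ _ snd (fun z : prod_topology G => z i)).
    exact: cvg_snd.
  exact: prodg_proj_continuous.
apply: (@continuous_comp _ _ _
  (fun y : prod_topology G * prod_topology G => (y.1 i, y.2 i))
  (fun y : G i * G i => y.1 * y.2)); last exact: mulg_continuous.
exact: (cvg_pair c1 c2).
Qed.

Fact prodg_inv_continuous : continuous (fun x : prod_topology G => x^-1).
Proof.
apply: prodg_continuous => i x.
apply: (@continuous_comp _ _ _ (fun x : prod_topology G => x i)
  (fun y : G i => y^-1)); first exact: prodg_proj_continuous.
exact: invg_continuous.
Qed.

HB.instance Definition _ := isTopologicalGroup.Build (prod_topology G)
  prodg_mul_continuous prodg_inv_continuous.

End ProductGroup.

Section ProductMap.
Variables (I : Type) (G H : I -> topologicalGroupType).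
Variable f : forall i, {multiplicative G i -> H i}.

Definition prodg_map (x : prod_topology G) : prod_topology H :=
  fun i => f i (x i).

Fact prodg_map_mul : {morph prodg_map : x y / x * y}.
Proof.
by move=> x y; apply: functional_extensionality_dep => i; exact: gmulfM.
Qed.

HB.instance Definition _ :=
  isMultiplicative.Build (prod_topology G) (prod_topology H) prodg_map
    prodg_map_mul.

Lemma prodg_map_continuous :
  (forall i, continuous (f i)) -> continuous prodg_map.
Proof.
move=> fc; apply: prodg_continuous => i x.
by apply: continuous_comp; [exact: prodg_proj_continuous|exact: fc].
Qed.

Lemma prodg_map_surj :
  (forall i, set_surj setT setT (f i)) -> set_surj setT setT prodg_map.
Proof.
move=> fs y _; have fsy i : exists x, f i x = y i.
  by have [x _ <-] := fs i (y i) Logic.I; exists x.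
exists (fun i => projT1 (cid (fsy i))) => //.
by apply: functional_extensionality_dep => i; exact: projT2 (cid (fsy i)).
Qed.

End ProductMap.

Section Definitions.
Implicit Types G Gt H : topologicalGroupType.

Definition thin G (U M : set G) :=
  nbhs 1 (\bigcap_(x in M) [set x^-1 * u * x | u in U]).

(* The convention is [x, y] = x y x^-1 y^-1, whereas [~ x, y] is
   x^-1 y^-1 x y. *)
Definition comm_set G (g : G) (K : set G) :=
  [set g * k * g^-1 * k^-1 | k in K].

Definition group_section G H (f : G -> H) (s : H -> G) :=
  [/\ injective s, forall h, f (s h) = h & s 1 = 1].

Definition quasihomomorphism G H (t : H -> G) :=
  [/\ t 1 = 1,
      {for (1, 1), continuous
        (fun h : H * H => t h.1 * t h.2 * (t (h.1 * h.2))^-1)} &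
      forall y, {for 1, continuous
        (fun h => t y * t h * (t y)^-1 * (t (y * h * y^-1))^-1)}].

Definition A_open G H (f : {multiplicative G -> H}) :=
  forall U : set G, nbhs 1 U ->
    (exists2 V, nbhs 1 V & thin (f @^-1` (f @` U)) (f @^-1` V)) /\
    (forall g, exists2 V, nbhs 1 V &
       comm_set g (f @^-1` V) `<=` f @^-1` (f @` U)).

Definition strongly_A_open G H (f : {multiplicative G -> H}) :=
  forall U : set G, nbhs 1 U ->
    (exists2 V, nbhs 1 V & thin U (f @^-1` V)) /\
    (forall g, exists2 V, nbhs 1 V & comm_set g (f @^-1` V) `<=` U).

Definition Astar_section G H (s : H -> G) :=
  forall U : set G, nbhs 1 U ->
    (exists2 V, nbhs 1 V & thin U (s @` V)) /\
    (forall g, exists2 V, nbhs 1 V & comm_set g (s @` V) `<=` U).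

Definition Astar_open G H (f : {multiplicative G -> H}) :=
  exists2 s, group_section f s & Astar_section s.

Definition strongly_Astar_open G H (f : {multiplicative G -> H}) :=
  exists s, [/\ group_section f s, Astar_section s & quasihomomorphism s].

(* [j] identifies [G] with a subgroup of [Gt]; the equation on [open] says
   that the subspace topology of this subgroup is the topology of [G]. *)
Definition topological_normal_embedding G Gt (j : {multiplicative G -> Gt}) :=
  [/\ injective j,
      open = [set j @^-1` V | V in @open Gt] &
      forall (g : Gt) x, range j x -> range j (g * x * g^-1)].

Definition semitopological G H (f : {multiplicative G -> H}) :=
  exists (Gt : topologicalGroupType) (j : {multiplicative G -> Gt})
         (ft : {multiplicative Gt -> H}),
    [/\ topological_normal_embedding j,
        continuous ft,
        forall U, open U -> open (ft @` U) &
        forall x, ft (j x) = f x].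

End Definitions.

(* Main.v *)
Require Import Defs.
From mathcomp Require Import all_boot all_classical.
From mathcomp Require Import topology.

(**
  Everything rests on two features of a product group [P] of groups [G i].

  From the factors to the product: the neighborhoods of a point contain boxes
  [box W] with [W i = setT] for almost all [i] ([nbhs_prodP]). Given such a
  box, choose in every factor the neighborhood that the hypothesis on that
  factor provides for [W i]. This choice can be [setT] whenever [W i = setT],
  so that only finitely many factors restrict anything and the product of the
  chosen sets is again a neighborhood ([nbhs_box_support]).

  From the product to a factor: [G i] is a retract of [P], through the
  continuous homomorphism [prodg_inj] that fills the other coordinates with
  [1], and the projection [x |-> x i]. Conditions on the product are pulled
  back along the former and pushed forward along the latter. A section [s] of
  the product map becomes the section [h |-> s (prodg_inj h) i].

  A-openness, strong A-openness and the condition on an A*-section are one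
  condition [thin_comm q r] for different pairs of relations: [q] tells how a
  neighborhood [U] is enlarged before thinness and commutators are compared
  with it (equality, or having the same image under [f]), and [r] tells which
  elements of [G] lie over an element of [H] (the fiber of [f], or the value
  of the section). Both transfers are proved once, in [thin_comm_prod] and
  [thin_comm_factor]. The quasihomomorphism conditions are continuity
  statements that are transferred coordinatewise.

  For semitopological maps, the product of the extensions [Gt i -> H i] is an
  extension. It is open because each factor is open and also surjective,
  already on [G i]; surjectivity is what makes the image of a box with almost
  all sides full such a box again ([prodg_map_open]).
*)

Set Implicit Arguments.
Unset Strict Implicit.
Unset Printing Implicit Defensive.

Local Open Scope classical_set_scope.
Local Open Scope group_scope.

(** * Neighborhoods in a product *)

Section ProductNeighborhoods.
Variables (I : Type) (T : I -> topologicalType).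
Implicit Types (x y : prod_topology T) (W : forall i, set (T i)).

Definition box W : set (prod_topology T) := [set y | forall i, W i (y i)].

Definition box_nbhs x W :=
  finite_set [set i | W i <> setT] /\ forall i, nbhs (x i) (W i).

(** The sets containing a box around [x] form a filter along which every
    projection converges, and the neighborhood filter of the product is the coarsest
    filter with this property. *)
Lemma nbhs_prodP x (U : set (prod_topology T)) :
  nbhs x U <-> exists2 W, box_nbhs x W & box W `<=` U.
Proof.
split=> [xU|[W [finW xW] WU]].
- pose B : set_system (prod_topology T) :=
    [set U | exists2 W, box_nbhs x W & box W `<=` U].
  have filterB : Filter B.
    split.
    + exists (fun=> setT) => //; split=> [|i]; last exact: filterT.
      by apply: (sub_finite_set _ (finite_set0 I)) => i /=; apply.
    + move=> A1 A2 [W1 [fin1 xW1] WA1] [W2 [fin2 xW2] WA2].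
      exists (fun i => W1 i `&` W2 i).
        split=> [|i]; last exact: filterI.
        have /sub_finite_set : [set i | W1 i `&` W2 i <> setT] `<=`
            [set i | W1 i <> setT] `|` [set i | W2 i <> setT].
          move=> i /= W12; have [W1T|] := pselect (W1 i = setT); last by left.
          by right=> W2T; apply: W12; rewrite W1T W2T setIT.
        by apply; rewrite finite_setU.
      by move=> y W12y; split; [apply: WA1|apply: WA2] => i; case: (W12y i).
    + by move=> A1 A2 A12 [W xW WA1]; exists W => //; exact: subset_trans A12.
  suff : B --> x by apply.
  apply/cvg_sup => i A [V [[Wi oWi <-] /= Wix] WiA].
  (* A neighborhood in one coordinate is a box with a single proper side. *)
  pose W := @dfwith {classic I} (fun j => set (T j)) (fun=> setT) i Wi.
  exists W; last first.
    move=> y Wy; apply: WiA => /=.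
    by have := Wy i; rewrite /W (@dfwithin {classic I}).
  split=> [|j].
    apply: (sub_finite_set _ (finite_set1 i)) => j /=.
    by rewrite /W; case: (@dfwithP {classic I}).
  rewrite /W; case: (@dfwithP {classic I}) => [|k _]; last exact: filterT.
  exact: open_nbhs_nbhs.
- apply: (filterS WU).
  pose D : set {classic I} := [set i | W i <> setT].
  have : nbhs x (\bigcap_(i in D) [set y : prod_topology T | W i (y i)]).
    have /finite_fsetP[E ->] : finite_set D by [].
    apply: filter_bigI => i _.
    exact: (@proj_continuous {classic I} T i x _ (xW i)).
  apply: filterS => y Dy i.
  have [->//|WT] := pselect (W i = setT).
  exact: Dy.
Qed.

End ProductNeighborhoods.

(** The finiteness of the set of proper sides passes from [W] to [W'], even
    when the two boxes live in different products over the same index set;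
    this is how a box of [G] controls one of [H]. *)
Lemma nbhs_box_support (I : Type) (S T : I -> topologicalType)
    (x : prod_topology S) (y : prod_topology T) W W' :
  box_nbhs x W -> (forall i, W i = setT -> W' i = setT) ->
  (forall i, nbhs (y i) (W' i)) -> nbhs y (box W').
Proof.
move=> [finW _] WW' yW'; apply/nbhs_prodP; exists W' => //; split=> //.
by apply: (sub_finite_set _ finW) => i /= W'T /WW'.
Qed.

(** * The common form of the openness conditions *)

Section ThinComm.
Implicit Types G H : topologicalGroupType.

(** Covers [f @^-1` V], [f @^-1` (f @` U)] and [s @` V] at once. A relation,
    unlike an operator on sets, can be compared with its coordinates. *)
Definition relim A B (R : A -> B -> Prop) (X : set A) : set B :=
  [set b | exists2 a, X a & R a b].

Definition thin_comm G H (q : G -> G -> Prop) (r : H -> G -> Prop) :=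
  forall U : set G, nbhs 1 U ->
    (exists2 V, nbhs 1 V & thin (relim q U) (relim r V)) /\
    (forall g, exists2 V, nbhs 1 V & comm_set g (relim r V) `<=` relim q U).

(** Conjugating back turns the intersection of the sets [x^-1 U x] into a
    pointwise condition, which can be checked coordinate by coordinate. *)
Lemma thinP G (U M : set G) :
  thin U M <-> nbhs 1 [set u | forall x, M x -> U (x * u * x^-1)].
Proof.
rewrite /thin; suff -> : \bigcap_(x in M) [set x^-1 * u * x | u in U] =
    [set u | forall x, M x -> U (x * u * x^-1)] by [].
apply/seteqP; split=> u /= Mu x Mx.
  have [v Uv <-] := Mu x Mx.
  by rewrite !mulgA mulgV mul1g -mulgA mulgV mulg1.
exists (x * u * x^-1); first exact: Mu.
by rewrite !mulgA mulVg mul1g -mulgA mulVg mulg1.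
Qed.

Lemma relim_eq A : relim (fun a b : A => a = b) = id.
Proof.
by apply/funext => X; apply/seteqP; split=> [a [b Xb <-]|a Xa] //; exists a.
Qed.

Lemma relim_preimage A B (f : B -> A) :
  relim (fun a b => f b = a) = preimage f.
Proof.
apply/funext => X; apply/seteqP.
by split=> [b [a Xa /= ->]|b Xb] //; exists (f b).
Qed.

Lemma A_openE G H (f : {multiplicative G -> H}) :
  A_open f = thin_comm (fun u y => f u = f y) (fun h x => f x = h).
Proof. by rewrite /thin_comm relim_preimage. Qed.

Lemma strongly_A_openE G H (f : {multiplicative G -> H}) :
  strongly_A_open f = thin_comm (fun u y => u = y) (fun h x => f x = h).
Proof. by rewrite /thin_comm relim_eq relim_preimage. Qed.

Lemma Astar_sectionE G H (s : H -> G) :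
  Astar_section s = thin_comm (fun u y => u = y) (fun h x => s h = x).
Proof. by rewrite /thin_comm relim_eq. Qed.

Lemma multiplicative1 (G H : groupType) (f : {multiplicative G -> H}) : f 1 = 1.
Proof. by apply: (mulgI (f 1)); rewrite -gmulfM !mulg1. Qed.

End ThinComm.

(** * Transfer of the common condition between product and factors *)

Section ProductThinComm.
Variables (I : Type) (G H : I -> topologicalGroupType).
Implicit Types K : I -> topologicalGroupType.

(** Reflexivity of [q] ensures that a full side [W i = setT] stays full after
    enlargement, so that the [i]-th factor imposes no constraint. *)
Lemma thin_comm_prod (q : forall i, G i -> G i -> Prop)
    (r : forall i, H i -> G i -> Prop)
    (Q : prod_topology G -> prod_topology G -> Prop)
    (R : prod_topology H -> prod_topology G -> Prop) :
  (forall i u, q i u u) ->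
  (forall u y, (forall i, q i (u i) (y i)) -> Q u y) ->
  (forall h x, R h x -> forall i, r i (h i) (x i)) ->
  (forall i, thin_comm (q i) (r i)) -> thin_comm Q R.
Proof.
move=> qxx qQ Rr tc U /nbhs_prodP[W WU WsubU]; have [finW W1] := WU.
have relimT i : W i = setT -> forall y, relim (q i) (W i) y.
  by move=> -> y; exists y.
have relimQ y : (forall i, relim (q i) (W i) (y i)) -> relim Q U y.
  move=> Wy; have [u Wu quy] := all_sig2 (fun i => cid2 (Wy i)).
  by exists u; [exact: WsubU|exact: qQ].
have relimR V x : relim R (box V) x -> forall i, relim (r i) (V i) (x i).
  by move=> [h Vh /Rr rhx] i; exists (h i).
split=> [|g].
- (* Take the full neighborhood wherever the box has a full side. *)
  have VP i : exists V, [/\ nbhs 1 V, W i = setT -> V = setT &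
      thin (relim (q i) (W i)) (relim (r i) V)].
    have [WT|WT] := pselect (W i = setT); last first.
      by have [[V V1 Vthin] _] := tc i _ (W1 i); exists V; split.
    exists setT; split=> //; first exact: filterT.
    by apply/thinP; apply: filterS filterT => u _ x _; exact: relimT.
  have [V {}VP] := all_sig (fun i => cid (VP i)).
  exists (box V).
    by apply: (nbhs_box_support WU) => i; case: (VP i).
  apply/thinP.
  apply: (@filterS _ (nbhs (1 : prod_topology G)) _ (box (fun i => [set u |
      forall x, relim (r i) (V i) x -> relim (q i) (W i) (x * u * x^-1)]))).
    by move=> u /= Wu x /relimR Vx; apply: relimQ => i; exact: Wu.
  apply: (nbhs_box_support WU) => i.
    by move=> WT; apply/seteqP; split=> // u _ x _; exact: relimT.
  by apply/thinP; case: (VP i).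
- have VP i : exists V, [/\ nbhs 1 V, W i = setT -> V = setT &
      comm_set (g i) (relim (r i) V) `<=` relim (q i) (W i)].
    have [WT|WT] := pselect (W i = setT); last first.
      by have [_ /(_ (g i))[V V1 Vcomm]] := tc i _ (W1 i); exists V; split.
    exists setT; split=> //; first exact: filterT.
    by move=> u _; exact: relimT.
  have [V {}VP] := all_sig (fun i => cid (VP i)).
  exists (box V).
    by apply: (nbhs_box_support WU) => i; case: (VP i).
  move=> _ [k /relimR Vk <-]; apply: relimQ => i.
  by have [_ _] := VP i; apply; exists (k i).
Qed.

Definition prodg_inj (K : I -> topologicalGroupType) i (x : K i) :
  prod_topology K := @dfwith {classic I} K (1 : prod_topology K) i x.

Lemma prodg_inj_in K i (x : K i) : prodg_inj x i = x.
Proof. exact: (@dfwithin {classic I}). Qed.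

Lemma prodg_inj1 K i : prodg_inj (1 : K i) = 1.
Proof.
apply: functional_extensionality_dep => j; rewrite /prodg_inj.
by case: (@dfwithP {classic I}).
Qed.

Lemma prodg_inj_continuous K i : continuous (@prodg_inj K i).
Proof.
exact: (@dfwith_continuous {classic I} (fun j => K j : topologicalType)
  (1 : prod_topology K) i).
Qed.

Lemma prodg_map_inj (f : forall i, {multiplicative G i -> H i}) i (x : G i) :
  prodg_map f (prodg_inj x) = prodg_inj (f i x).
Proof.
apply: functional_extensionality_dep => j; rewrite /prodg_map /prodg_inj.
case: (@dfwithP {classic I}) => [|k ik].
  by rewrite (@dfwithin {classic I}).
by rewrite (@dfwithout {classic I})//; exact: multiplicative1.
Qed.

(** Test the condition on the product at the cylinder over [U]. The second
    hypothesis lifts the elements over [h] to elements over [prodg_inj h]; the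
    lift need not be [prodg_inj x]: when [R] comes from a section [s], it is
    [s (prodg_inj h)], whose other coordinates are arbitrary. *)
Lemma thin_comm_factor i (q : G i -> G i -> Prop) (r : H i -> G i -> Prop)
    (Q : prod_topology G -> prod_topology G -> Prop)
    (R : prod_topology H -> prod_topology G -> Prop) :
  (forall u y, Q u y -> q (u i) (y i)) ->
  (forall h x, r h x -> exists2 x', R (prodg_inj h) x' & x' i = x) ->
  thin_comm Q R -> thin_comm q r.
Proof.
move=> Qq rR tc U U1.
have injN K (V : set (prod_topology K)) : nbhs 1 V ->
    nbhs 1 ((@prodg_inj K i) @^-1` V).
  by move=> V1; apply: prodg_inj_continuous; rewrite prodg_inj1.
have projU : nbhs (1 : prod_topology G) [set x | U (x i)].
  exact: (@prodg_proj_continuous _ G i 1 U U1).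
have relimU y : relim Q [set x | U (x i)] y -> relim q U (y i).
  by move=> [u Uu /Qq]; exists (u i).
have relimR V x : relim r ((@prodg_inj H i) @^-1` V) x ->
    exists2 x', relim R V x' & x' i = x.
  by move=> [h Vh /rR[x' Rx' <-]]; exists x' => //; exists (prodg_inj h).
have [[V V1 /thinP Vthin] Vcomm] := tc _ projU; split=> [|g].
  exists (@prodg_inj H i @^-1` V); first exact: injN.
  apply/thinP; apply: filterS (injN _ _ Vthin) => u /= Vu x /relimR[x' Vx' <-].
  by rewrite -[u]prodg_inj_in; exact: relimU (Vu x' Vx').
have {Vthin V1 V}[V V1 Vg] := Vcomm (prodg_inj g).
exists (@prodg_inj H i @^-1` V); first exact: injN.
move=> _ [x /relimR[x' Vx' <-] <-].
rewrite -[g]prodg_inj_in.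
apply: (relimU (prodg_inj g * x' * (prodg_inj g)^-1 * x'^-1)).
by apply: Vg; exists x'.
Qed.

End ProductThinComm.

(** * Quasihomomorphisms *)

Lemma continuous_pair_map (S1 S2 T1 T2 : topologicalType)
    (f : S1 -> T1) (g : S2 -> T2) x y :
  {for x, continuous f} -> {for y, continuous g} ->
  {for (x, y), continuous (fun z => (f z.1, g z.2))}.
Proof.
move=> fx gy; apply: cvg_pair.
  by apply: (@continuous_comp _ _ _ fst f); [exact: cvg_fst|exact: fx].
by apply: (@continuous_comp _ _ _ snd g); [exact: cvg_snd|exact: gy].
Qed.

Section ProductQuasihomomorphism.
Variables (I : Type) (G H : I -> topologicalGroupType).

Lemma prodg_continuous_at (S : topologicalType) (h : S -> prod_topology G) x :
  (forall i, {for x, continuous (fun t => h t i)}) -> {for x, continuous h}.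
Proof.
move=> hx; apply/cvg_sup => i U [V [[W oW <-] /= Wx] WU].
by apply: (filterS WU); apply: (hx i); exact: open_nbhs_nbhs.
Qed.

Lemma quasihomomorphism_prod (t : forall i, H i -> G i) :
  (forall i, quasihomomorphism (t i)) ->
  quasihomomorphism
    (fun h : prod_topology H => (fun i => t i (h i)) : prod_topology G).
Proof.
move=> tq; split=> [||y].
- by apply: functional_extensionality_dep => i; case: (tq i).
- apply: prodg_continuous_at => i; have [_ tc _] := tq i.
  have proj2 : {for (1, 1), continuous
      (fun h : prod_topology H * prod_topology H => (h.1 i, h.2 i))}.
    apply: (@continuous_pair_map _ _ _ _ (fun h : prod_topology H => h i)
      (fun h : prod_topology H => h i)); exact: prodg_proj_continuous.
  have c := continuous_comp proj2 tc; exact: c.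
- apply: prodg_continuous_at => i; have [_ _ /(_ (y i)) tc] := tq i.
  have c := continuous_comp (@prodg_proj_continuous _ H i 1) tc; exact: c.
Qed.

Lemma prodg_inj_mul i (x y : H i) :
  prodg_inj (x * y) = prodg_inj x * prodg_inj y.
Proof.
apply: functional_extensionality_dep => j.
rewrite -[RHS]/(prodg_inj x j * prodg_inj y j) /prodg_inj.
case: (@dfwithP {classic I}) => [|k ik].
  by rewrite !(@dfwithin {classic I}).
by rewrite !(@dfwithout {classic I})//; exact/esym/mulg1.
Qed.

Lemma prodg_inj_inv i (x : H i) : prodg_inj x^-1 = (prodg_inj x)^-1.
Proof.
by apply: (mulgI (prodg_inj x)); rewrite -prodg_inj_mul !mulgV prodg_inj1.
Qed.

Lemma quasihomomorphism_factor (t : prod_topology H -> prod_topology G) i :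
  quasihomomorphism t ->
  quasihomomorphism (fun h : H i => t (prodg_inj h) i).
Proof.
move=> [t1 t2c tyc].
have projc x : {for x, continuous (fun z : prod_topology G => z i)}.
  exact: prodg_proj_continuous.
split=> [||y].
- by rewrite prodg_inj1 t1.
- pose inj2 (h : H i * H i) := (prodg_inj h.1, prodg_inj h.2).
  pose t2 (h : prod_topology H * prod_topology H) :=
    t h.1 * t h.2 * (t (h.1 * h.2))^-1.
  have inj2c : {for (1, 1), continuous inj2}.
    by apply: continuous_pair_map; exact: prodg_inj_continuous.
  have -> : (fun h : H i * H i => t (prodg_inj h.1) i * t (prodg_inj h.2) i *
      (t (prodg_inj (h.1 * h.2)) i)^-1) = (fun z => t2 z i) \o inj2.
    by apply/funext => h; rewrite prodg_inj_mul.
  apply: continuous_comp inj2c _; rewrite /inj2 /= prodg_inj1.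
  by have c := continuous_comp t2c (projc _); exact: c.
- pose ty h := t (prodg_inj y) * t h * (t (prodg_inj y))^-1 *
    (t (prodg_inj y * h * (prodg_inj y)^-1))^-1.
  have -> : (fun h : H i => t (prodg_inj y) i * t (prodg_inj h) i *
      (t (prodg_inj y) i)^-1 * (t (prodg_inj (y * h * y^-1)) i)^-1) =
      (fun z => ty z i) \o @prodg_inj I H i.
    by apply/funext => h; rewrite !prodg_inj_mul prodg_inj_inv.
  apply: continuous_comp; first exact: prodg_inj_continuous.
  rewrite prodg_inj1.
  by have c := continuous_comp (tyc (prodg_inj y)) (projc _); exact: c.
Qed.

End ProductQuasihomomorphism.

(** * Semitopological homomorphisms *)

Section ProductSemitopological.
Variables (I : Type) (G H : I -> topologicalGroupType).

(** Localizes the equality between the topology of [S] and the one induced by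
    [j], so that boxes can be used. Conversely, an open set of [S] is the trace
    of the union of all open sets whose trace it contains. *)
Lemma inducing_nbhs (S T : topologicalType) (j : S -> T) :
  open = [set j @^-1` V | V in @open T] <->
  forall x U, nbhs x U <-> exists2 V, nbhs (j x) V & j @^-1` V `<=` U.
Proof.
split=> [openj x U|nbhsj].
  split=> [|[V + VU]]; rewrite nbhsE.
    move=> [V [+ Vx] VU]; rewrite openj => -[W oW WV]; exists W.
      by apply: open_nbhs_nbhs; split=> //; rewrite -WV in Vx.
    by rewrite WV.
  move=> [W [oW Wjx] WV]; apply: (@filterS _ (nbhs x) _ (j @^-1` W)).
    by move=> y /WV /VU.
  by apply: open_nbhs_nbhs; split=> //; rewrite openj; exists W.
apply/seteqP; split=> [U oU|_ [V oV <-]].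
  exists (\bigcup_(V in [set V | open V /\ j @^-1` V `<=` U]) V).
    by apply: bigcup_open => V [].
  apply/seteqP; split=> [x [V [_ VU] Vx]|x Ux]; first exact: VU.
  have /nbhsj[V] : nbhs x U by exact: open_nbhs_nbhs.
  rewrite nbhsE => -[W [oW Wjx] WV] VU; exists W => //; split=> //.
  by move=> y Wy; exact/VU/WV.
rewrite openE => x Vx; apply/nbhsj; exists V => //; exact: open_nbhs_nbhs.
Qed.

(** A neighborhood of [x i] that is full is the trace of the full set, so the
    traces of boxes of the larger product form a base of the smaller one. *)
Lemma topological_normal_embedding_prod (K : I -> topologicalGroupType)
    (j : forall i, {multiplicative G i -> K i}) :
  (forall i, topological_normal_embedding (j i)) ->
  topological_normal_embedding
    (prodg_map j : {multiplicative prod_topology G -> prod_topology K}).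
Proof.
move=> ej; split.
- move=> x y xy; apply: functional_extensionality_dep => i.
  by have [+ _ _] := ej i; apply; exact: (congr1 (fun z => z i) xy).
- have jP i := (inducing_nbhs (j i)).1 (let: And3 _ jo _ := ej i in jo).
  apply/inducing_nbhs => x U; split=> [/nbhs_prodP[W xW WU]|[V jxV VU]].
    have VP i : exists V, [/\ nbhs (j i (x i)) V, W i = setT -> V = setT &
        j i @^-1` V `<=` W i].
      have [WT|WT] := pselect (W i = setT).
        by exists setT; split=> // [|y _]; [exact: filterT|rewrite WT].
      by have [V] := (jP i _ _).1 (xW.2 i); exists V; split.
    have [V {}VP] := all_sig (fun i => cid (VP i)).
    exists (box V).
      by apply: (nbhs_box_support xW) => i; case: (VP i).
    by move=> y Vy; apply: WU => i; have [_ _] := VP i; apply; exact: Vy.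
  apply: (filterS VU); apply: (@prodg_map_continuous I G K j) => // i y A yA.
  by apply/jP; exists A.
- move=> g _ [x _ <-]; have zP i : exists z, j i z = g i * j i (x i) * (g i)^-1.
    have [_ _ jn] := ej i.
    by have [|z _ <-] := jn (g i) (j i (x i)); [exists (x i)|exists z].
  have [z {}zP] := all_sig (fun i => cid (zP i)); exists z => //.
  exact: functional_extensionality_dep.
Qed.

(** Surjectivity keeps the full sides of a box full in the image; infinitely
    many proper sides would prevent the image from being a neighborhood. *)
Lemma prodg_map_open (K : I -> topologicalGroupType)
    (f : forall i, {multiplicative K i -> H i}) :
  (forall i, set_surj setT setT (f i)) ->
  (forall i U, open U -> open (f i @` U)) ->
  forall U, open U -> open (prodg_map f @` U).
Proof.
move=> fs fo U; rewrite !openE => oU _ [x Ux <-].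
have /nbhs_prodP[W xW WU] := oU x Ux.
have fW : box (fun i => f i @` W i) `<=` prodg_map f @` U.
  move=> y fWy; have [z Wz fz] := all_sig2 (fun i => cid2 (fWy i)).
  by exists z; [exact: WU|exact: functional_extensionality_dep].
apply: (filterS fW); apply: (nbhs_box_support xW) => i.
  by move=> ->; apply/seteqP; split=> // y _; exact: fs.
have := xW.2 i; rewrite !nbhsE => -[V [oV Vx] VW]; exists (f i @` V).
  by split; [exact: fo|exists (x i)].
exact: image_subset.
Qed.

Lemma semitopological_prod (f : forall i, {multiplicative G i -> H i}) :
  (forall i, set_surj setT setT (f i)) ->
  (forall i, semitopological (f i)) ->
  semitopological
    (prodg_map f : {multiplicative prod_topology G -> prod_topology H}).
Proof.
move=> fs st; have [K {}st] := all_sig (fun i => cid (st i)).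
have [j {}st] := all_sig (fun i => cid (st i)).
have [ft {}st] := all_sig (fun i => cid (st i)).
exists (prod_topology K), (prodg_map j), (prodg_map ft); split.
- by apply: topological_normal_embedding_prod => i; case: (st i).
- by apply: prodg_map_continuous => i; case: (st i).
- apply: prodg_map_open => i; have [_ _ fto ftj] := st i => //.
  by move=> y _; have [x _ <-] := fs i y Logic.I; exists (j i x).
- move=> x; apply: functional_extensionality_dep => i.
  by have [_ _ _ ftj] := st i; exact: ftj.
Qed.

End ProductSemitopological.

(** * Sections *)

Section ProductSection.
Variables (I : Type) (G H : I -> topologicalGroupType).
Variable f : forall i, {multiplicative G i -> H i}.

Lemma group_section_prod (s : forall i, H i -> G i) :
  (forall i, group_section (f i) (s i)) ->
  group_section (prodg_map f)
    (fun h : prod_topology H => (fun i => s i (h i)) : prod_topology G).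
Proof.
move=> sP.
have fsK (h : prod_topology H) :
    prodg_map f (fun i => s i (h i) : G i) = h.
  apply: functional_extensionality_dep => i.
  by have [_ sK _] := sP i; exact: sK.
split=> //; first exact: (can_inj fsK).
by apply: functional_extensionality_dep => i; case: (sP i).
Qed.

Lemma group_section_factor (s : prod_topology H -> prod_topology G) i :
  group_section (prodg_map f) s ->
  group_section (f i) (fun h : H i => s (prodg_inj h) i).
Proof.
move=> [_ fsK s1].
have fsiK (h : H i) : f i (s (prodg_inj h) i) = h.
  by rewrite -[RHS]prodg_inj_in -[in RHS](fsK (prodg_inj h)).
split=> //; first exact: (can_inj fsiK).
by rewrite prodg_inj1 s1.
Qed.

Lemma Astar_section_prod (s : forall i, H i -> G i) :
  (forall i, Astar_section (s i)) ->
  Astar_section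
    (fun h : prod_topology H => (fun i => s i (h i)) : prod_topology G).
Proof.
move=> sA; rewrite Astar_sectionE.
apply: (@thin_comm_prod _ _ _ (fun i u y => u = y) (fun i h x => s i h = x)).
- by [].
- by move=> u y; exact: functional_extensionality_dep.
- by move=> h _ <-.
- by move=> i; rewrite -Astar_sectionE.
Qed.

Lemma Astar_section_factor (s : prod_topology H -> prod_topology G) i :
  Astar_section s -> Astar_section (fun h : H i => s (prodg_inj h) i).
Proof.
rewrite !Astar_sectionE; apply: thin_comm_factor => [u y -> //|h x <-].
by exists (s (prodg_inj h)).
Qed.

End ProductSection.

(** * The product theorem *)

Theorem theorem6p15 (I : Type) (G H : I -> topologicalGroupType)
    (f : forall i, {multiplicative G i -> H i})
    (f_cont : forall i, continuous (f i))
    (f_surj : forall i, set_surj setT setT (f i)) :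
  let F : {multiplicative prod_topology G -> prod_topology H} :=
    prodg_map f in
  [/\ (forall i, semitopological (f i)) -> semitopological F,
      (forall i, A_open (f i)) <-> A_open F,
      (forall i, Astar_open (f i)) <-> Astar_open F,
      (forall i, strongly_Astar_open (f i)) <-> strongly_Astar_open F &
      (forall i, strongly_A_open (f i)) <-> strongly_A_open F].
Proof.
move=> F; split.
- exact: semitopological_prod.
- split=> [fA|FA i].
    rewrite A_openE; apply: (@thin_comm_prod _ _ _
      (fun i u y => f i u = f i y) (fun i h x => f i x = h)) => //.
    + by move=> u y; exact: functional_extensionality_dep.
    + by move=> h x <-.
    + by move=> i; rewrite -A_openE.
  rewrite A_openE; rewrite A_openE in FA; apply: thin_comm_factor FA.
    by move=> u y /(congr1 (fun z => z i)).
  move=> h x <-; exists (prodg_inj x); first exact: prodg_map_inj.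
  exact: prodg_inj_in.
- split=> [fA|[s sP sA] i].
    have [s sP sA] := all_sig2 (fun i => cid2 (fA i)).
    by exists (fun h i => s i (h i));
      [exact: group_section_prod|exact: Astar_section_prod].
  by exists (fun h => s (prodg_inj h) i);
    [exact: group_section_factor|exact: Astar_section_factor].
- split=> [fA|[s [sP sA sq]] i].
    have [s sP] := all_sig (fun i => cid (fA i)).
    exists (fun h i => s i (h i)); split.
    + by apply: group_section_prod => i; case: (sP i).
    + by apply: Astar_section_prod => i; case: (sP i).
    + by apply: quasihomomorphism_prod => i; case: (sP i).
  exists (fun h => s (prodg_inj h) i); split.
  + exact: group_section_factor.
  + exact: Astar_section_factor.
  + exact: quasihomomorphism_factor.
- split=> [fA|FA i].
    rewrite strongly_A_openE; apply: (@thin_comm_prod _ _ _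
      (fun i u y => u = y) (fun i h x => f i x = h)) => //.
    + by move=> u y; exact: functional_extensionality_dep.
    + by move=> h x <-.
    + by move=> i; rewrite -strongly_A_openE.
  rewrite strongly_A_openE; rewrite strongly_A_openE in FA.
  apply: thin_comm_factor FA => [u y -> //|h x <-].
  by exists (prodg_inj x); [exact: prodg_map_inj|exact: prodg_inj_in].
Qed.
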